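(* Let $\Sigma$ be a finite ranked alphabet containing a symbol of rank at least 1. A transduction $\tau\subseteq T_\Sigma\times T_\Sigma$ is an MCFT-transduction over $\Sigma$ if and only if it is a $\mathrm{DMT}_{\mathrm{fc}}$-bimorphism over $\Sigma$.
   Context: **Sequences and trees.** $\mathbb N_0$ is the set of nonnegative integers, $[n]=\{1,\dots,n\}$. $A^*$ (resp. $A^+$) is the set of finite (resp. nonempty finite) sequences over $A$; a sequence of length 1 is identified with its element; juxtaposition is concatenation; $\mathrm{occ}(w)$ is the set of elements occurring in the sequence $w$; $w$ is repetition-free if no element occurs twice in it. A ranked alphabet is a set $\Sigma$ with a rank map $\mathrm{rk}\colon\Sigma\to\mathbb N_0$ (applied elementwise to sequences); $\Sigma^{(k)}$ is the set of symbols of rank $k$. $T_\Sigma$ is the set of trees over $\Sigma$: the smallest set of strings over $\Sigma$ containing $\sigma t_1\cdots t_k$ (also written $\sigma(t_1,\dots,t_k)$) for all $\sigma\in\Sigma^{(k)}$ and $t_i\in T_\Sigma$. A forest is a finite sequence of trees. $X=\{x_1,x_2,\dots\}$ is a set of variables (of rank 0, disjoint from other alphabets), $X_k=\{x_1,\dots,x_k\}$. A pattern of rank $k$ over $\Sigma$ is a tree over $\Sigma\cup X_k$ in which each of $x_1,\dots,x_k$ occurs exactly once; $P_\Sigma(X_k)$ is the set of these and $P_\Sigma(X)=\bigcup_k P_\Sigma(X_k)$. For a forest $t$, $\mathrm{occ}_\Omega(t)$ is the set of symbols of $\Omega$ occurring in $t$; $t$ is uniquely $\Omega$-labeled if each symbol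 of $\Omega$ occurs at most once in $t$. **Substitution.** For a repetition-free sequence of symbols $\sigma=(\sigma_1,\dots,\sigma_n)$ and patterns $u=(u_1,\dots,u_n)$ with $\mathrm{rk}(u)=\mathrm{rk}(\sigma)$, $t[\sigma\gets u]$ is obtained from $t$ by replacing, recursively, each subtree $\sigma_i(s_1,\dots,s_k)$ by $u_i$ in which $x_j$ is replaced by the transformed $s_j$ (componentwise on forests). For $\mathcal L=\{B_1,\dots,B_k\}$ with $B_1\cdots B_k$ repetition-free and forests $f(B_i)$ with $\mathrm{rk}(f(B_i))=\mathrm{rk}(B_i)$, $t[B\gets f(B)\mid B\in\mathcal L]$ means $t[B_1\cdots B_k\gets f(B_1)\cdots f(B_k)]$. **MCFT-transducer.** An MCFT-transducer over $\Sigma$ is $G=(N,\mathcal N,\Sigma,S,R)$ where $N$ is a finite ranked alphabet of nonterminals; $\mathcal N\subseteq N^+$ is a finite set of repetition-free sequences (big nonterminals) with $\mathrm{occ}(A)\ne\mathrm{occ}(A')$ for distinct $A,A'\in\mathcal N$; $\Sigma$ is a finite ranked alphabet disjoint from $N$ containing a symbol of rank at least 1; $R$ is a finite set of rules $A\to(u,\mathcal L)$ with $A\in\mathcal N$, $u\in P_{N\cup\Sigma}(X)^+$ a uniquely $N$-labeled forest with $\mathrm{rk}(u)=\mathrm{rk}(A)$, and $\mathcal L\subseteq\mathcal N$ such that the sets $\mathrm{occ}(B)$, $B\in\mathcal L$, are pairwise disjoint with union $\mathrm{occ}_N(u)$; $S=(S_1,S_2)\in\mathcal N$ with $S_1,S_2\in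 N^{(0)}$ is the initial big nonterminal, and $S_1,S_2$ do not occur in right-hand sides of rules. Moreover $N$ is partitioned into $N_1$ and $N_2$ such that $S_1\in N_1$, $S_2\in N_2$, and for every rule $(A_1,\dots,A_n)\to((u_1,\dots,u_n),\mathcal L)$, $j\in[n]$ and $i\in\{1,2\}$: if $A_j\in N_i$ then $\mathrm{occ}_N(u_j)\subseteq N_i$. The sets $L(G,A)$, $A\in\mathcal N$, are simultaneously the smallest sets of forests such that for every rule $A\to(u,\mathcal L)$ and all $f(B)\in L(G,B)$ ($B\in\mathcal L$), $u[B\gets f(B)\mid B\in\mathcal L]\in L(G,A)$. $G$ realizes $\tau(G)=L(G,S)\subseteq T_\Sigma\times T_\Sigma$; such relations are the MCFT-transductions over $\Sigma$. **Macro tree transducers and bimorphisms.** A $\mathrm{DMT}_{\mathrm{sp}}$-transducer is $M=(Q,\Omega,\Sigma,q_0,R)$ with a finite ranked alphabet $Q$ of states, finite ranked alphabets $\Omega,\Sigma$ of input and output symbols with $Q\cap\Sigma=\emptyset$, an initial state $q_0\in Q^{(0)}$, and, for every $q\in Q^{(m)}$ and $\omega\in\Omega^{(k)}$, exactly one rule $\langle q,\omega(y_1,\dots,y_k)\rangle(x_1,\dots,x_m)\to\zeta$ with $\zeta=\mathrm{rhs}_M(q,\omega)\in P_{(Q\times Y_k)\cup\Sigma}(X_m)$, where $Y_k=\{y_1,\dots,y_k\}$ and $\langle q',y_i\rangle$ has the rank of $q'$. For $s=\omega(s_1,\dots,s_k)\in T_\Omega$, $M_q(s)=\mathrm{rhs}_M(q,\omega)[\langle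 q',y_i\rangle\gets M_{q'}(s_i)\mid q'\in Q,1\le i\le k]$. $M$ realizes the total function $s\mapsto M(s)=M_{q_0}(s)$ from $T_\Omega$ to $T_\Sigma$. For $\omega\in\Omega^{(k)}$, $i\in[k]$ and $q_1,\dots,q_n\in Q$, $\mathrm{sts}_{\omega,i}(q_1,\dots,q_n)\in Q^*$ is the sequence of states obtained from the string $\mathrm{rhs}_M(q_1,\omega)\cdots\mathrm{rhs}_M(q_n,\omega)$ by replacing each $\langle q',y_i\rangle$ by $q'$ and erasing all other symbols. The set $\mathrm{sts}(M)$ is the smallest subset of $Q^*$ containing $q_0$ and closed under all $\mathrm{sts}_{\omega,i}$. $M$ is finite-copying (a $\mathrm{DMT}_{\mathrm{fc}}$-transducer) if $\mathrm{sts}(M)$ is finite. A $\mathrm{DMT}_{\mathrm{fc}}$-bimorphism over $\Sigma$ is a relation $\{(M_1(s),M_2(s))\mid s\in L\}$ where $L$ is a regular tree language over some finite ranked alphabet $\Omega$ and $M_1,M_2$ are transductions realized by $\mathrm{DMT}_{\mathrm{fc}}$-transducers with input alphabet $\Omega$ and output alphabet $\Sigma$. *)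

(* Defs.v *)
From HB Require Import structures.
From mathcomp Require Import all_boot finmap.

Set Implicit Arguments.
Unset Strict Implicit.
Unset Printing Implicit Defensive.

(* Disjoint unions of alphabets are sum types, so
    that disjointness requirements hold by typing. *)

HB.mixin Record IsRanked T := { rk : T -> nat }.

#[short(type="rankedAlphabet")]
HB.structure Definition RankedAlphabet := { T of Finite T & IsRanked T }.

Definition sum_rk (A B : rankedAlphabet) (c : A + B) : nat :=
  match c with inl a => rk a | inr b => rk b end.
HB.instance Definition _ (A B : rankedAlphabet) :=
  IsRanked.Build (A + B)%type (@sum_rk A B).

(* [Var i] is the variable x_{i+1}. *)

Inductive term (A : Type) : Type :=
| Var of nat
| App of A & seq (term A).
Arguments Var {A} _.
Arguments App {A} _ _.

Section TermChoice.
Context {A : Type}.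

Lemma term_nested_ind (P : term A -> Prop) :
    (forall i, P (Var i)) ->
    (forall a ts, foldr (fun t => and (P t)) True ts -> P (App a ts)) ->
  forall t, P t.
Proof.
move=> PV PA; fix IH 1 => -[i|a ts]; first exact: PV.
by apply: PA; elim: ts => //= t ts IHts; split.
Qed.

Fixpoint term_encode (t : term A) : GenTree.tree (A + nat) :=
  match t with
  | Var i => GenTree.Leaf (inr i)
  | App a ts => GenTree.Node 0 (GenTree.Leaf (inl a) :: map term_encode ts)
  end.

Fixpoint term_decode (g : GenTree.tree (A + nat)) : option (term A) :=
  match g with
  | GenTree.Leaf (inr i) => Some (Var i)
  | GenTree.Node _ (GenTree.Leaf (inl a) :: gs) =>
      Some (App a (pmap term_decode gs))
  | _ => None
  end.

Lemma term_encodeK : pcancel term_encode term_decode.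
Proof.
elim/term_nested_ind => //= a ts IH; congr (Some (App a _)).
by elim: ts IH => //= t ts IHts [-> /IHts ->].
Qed.

End TermChoice.

HB.instance Definition _ (A : eqType) :=
  Equality.copy (term A) (pcan_type (@term_encodeK A)).
HB.instance Definition _ (A : choiceType) :=
  Choice.copy (term A) (pcan_type (@term_encodeK A)).

(* The labels, in the order of the string representation of the tree. *)
Fixpoint labels (A : Type) (t : term A) : seq A :=
  match t with
  | Var _ => [::]
  | App a ts => a :: flatten (map (@labels A) ts)
  end.

Definition left_labels (A B : Type) (t : term (A + B)) : seq A :=
  pmap (fun c => if c is inl a then Some a else None) (labels t).

Fixpoint vars (A : Type) (t : term A) : seq nat :=
  match t with
  | Var i => [:: i]
  | App _ ts => flatten (map (@vars A) ts)
  end.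

Fixpoint ranked (A : rankedAlphabet) (t : term A) : bool :=
  match t with
  | Var _ => true
  | App a ts => (size ts == rk a) && all (@ranked A) ts
  end.

Definition pattern (A : rankedAlphabet) (k : nat) (t : term A) : bool :=
  ranked t && perm_eq (vars t) (iota 0 k).

(* T_A coincides with the set of patterns of rank 0. *)
Definition is_tree (A : rankedAlphabet) (t : term A) : bool := pattern 0 t.

(* In [inst] and [big_env] the default value of [nth] is
    irrelevant for well-ranked arguments. *)

Fixpoint inst (A : Type) (ss : seq (term A)) (t : term A) : term A :=
  match t with
  | Var i => nth (Var i) ss i
  | App a ts => App a (map (inst ss) ts)
  end.

(* Every symbol of [A] is replaced, so the result is a term over [B] only. *)
Fixpoint subst (A B : Type) (f : A -> term B) (t : term (A + B)) : term B :=
  match t with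
  | Var i => Var i
  | App (inl a) ts => inst (map (subst f) ts) (f a)
  | App (inr b) ts => App b (map (subst f) ts)
  end.

(* A rule A -> (u, L) is the triple (A, u, L). *)
Definition mcft_rule (N Sigma : rankedAlphabet) : Type :=
  (seq N * seq (term (N + Sigma)%type) * {fset seq N})%type.

Definition forest_nonterminals (N Sigma : Type) (u : seq (term (N + Sigma))) :
    seq N :=
  flatten (map (@left_labels N Sigma) u).

Record mcft_rule_wf (N Sigma : rankedAlphabet) (bigs : {fset seq N})
    (A : seq N) (u : seq (term (N + Sigma)%type)) (L : {fset seq N}) : Prop := {
  rule_lhs : A \in bigs;
  (* [all2] also requires the lengths to be equal *)
  rule_rank : all2 (fun a t => pattern (rk a) t) A u;
  rule_uniquely_labeled : uniq (forest_nonterminals u);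
  rule_links : {subset L <= bigs};
  rule_links_disjoint :
    forall B B', B \in L -> B' \in L -> B != B' -> [disjoint B & B'];
  rule_links_cover :
    forall n, n \in forest_nonterminals u <-> exists2 B, B \in L & n \in B
}.

Record mcft_transducer (Sigma : rankedAlphabet) := {
  nonterminal : rankedAlphabet;
  bigs : {fset seq nonterminal};
  start1 : nonterminal;
  start2 : nonterminal;
  rules : {fset mcft_rule nonterminal Sigma};
  output_alphabet : exists a : Sigma, 0 < rk a;
  bigs_nonempty : forall A, A \in bigs -> A != [::];
  bigs_repetition_free : forall A, A \in bigs -> uniq A;
  bigs_occ : forall A A', A \in bigs -> A' \in bigs -> A =i A' -> A = A';
  start_big : [:: start1; start2] \in bigs;
  start_rank : rk start1 = 0 /\ rk start2 = 0;
  rules_wf : forall A u L, (A, u, L) \in rules -> mcft_rule_wf bigs A u L;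
  start_not_in_rhs : forall A u L, (A, u, L) \in rules ->
    start1 \notin forest_nonterminals u /\ start2 \notin forest_nonterminals u;
  nonterminal_partition : exists N1 N2 : {set nonterminal},
    [/\ N1 :|: N2 = [set: nonterminal], [disjoint N1 & N2],
        start1 \in N1, start2 \in N2 &
        forall A u L, (A, u, L) \in rules ->
        forall a t, (a, t) \in zip A u ->
          (a \in N1 -> {subset left_labels t <= N1}) /\
          (a \in N2 -> {subset left_labels t <= N2})]
}.

(* The assignment B_1...B_k <- f(B_1)...f(B_k) for L = {B_1, ..., B_k}. *)
Definition big_env (N : eqType) (Sigma : Type) (Bs : seq (seq N))
    (f : seq N -> seq (term Sigma)) (n : N) : term Sigma :=
  nth (Var 0) (flatten (map f Bs)) (index n (flatten Bs)).

Inductive mcft_language (Sigma : rankedAlphabet) (G : mcft_transducer Sigma) :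
    seq (nonterminal G) -> seq (term Sigma) -> Prop :=
| mcft_language_rule A u L f :
    (A, u, L) \in rules G ->
    (forall B, B \in L -> mcft_language B (f B)) ->
    mcft_language A (map (subst (big_env L f)) u).

Definition mcft_transduction (Sigma : rankedAlphabet)
    (tau : term Sigma -> term Sigma -> Prop) : Prop :=
  exists G : mcft_transducer Sigma, forall t1 t2,
    tau t1 t2 <-> mcft_language [:: start1 G; start2 G] [:: t1; t2].

(* The pair (q, i) is the symbol <q, y_{i+1}>. *)
Definition call (Q : Type) (k : nat) : Type := (Q * 'I_k)%type.
HB.instance Definition _ (Q : rankedAlphabet) k := Finite.on (call Q k).
Definition call_rk (Q : rankedAlphabet) k (c : call Q k) : nat := rk c.1.
HB.instance Definition _ (Q : rankedAlphabet) k :=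
  IsRanked.Build (call Q k) (@call_rk Q k).

Record dmt_sp (Omega Sigma : rankedAlphabet) := {
  state : rankedAlphabet;
  initial : state;
  initial_rank : rk initial = 0;
  rhs : state -> forall w : Omega, term (call state (rk w) + Sigma)%type;
  rhs_pattern : forall q w, pattern (rk q) (rhs q w)
}.

Section Dmt.
Variables (Omega Sigma : rankedAlphabet) (M : dmt_sp Omega Sigma).

(* Only meaningful on trees: variables and missing subtrees get a dummy. *)
Fixpoint dmt_eval (s : term Omega) : state M -> term Sigma :=
  match s with
  | Var _ => fun=> Var 0
  | App w ss =>
      let rs := map dmt_eval ss in
      fun q =>
        subst (fun c : call (state M) (rk w) => nth (fun=> Var 0) rs c.2 c.1)
              (rhs q w)
  end.

Definition dmt_apply (s : term Omega) : term Sigma := dmt_eval s (initial M).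

Definition state_sequence (w : Omega) (i : 'I_(rk w)) (qs : seq (state M)) :
    seq (state M) :=
  flatten [seq [seq c.1 | c <- left_labels (rhs q w) & c.2 == i] | q <- qs].

Inductive sts : seq (state M) -> Prop :=
| sts_initial : sts [:: initial M]
| sts_step w (i : 'I_(rk w)) qs : sts qs -> sts (state_sequence i qs).

Definition finite_copying : Prop :=
  exists l : seq (seq (state M)), forall qs, sts qs -> qs \in l.

End Dmt.

(* Nondeterministic bottom-up automata; only sequences of states of the
   appropriate length are related, so the transition relation is finite. *)
Record tree_automaton (Omega : rankedAlphabet) := {
  astate : finType;
  transition : forall w : Omega, (rk w).-tuple astate -> pred astate;
  final : {set astate}
}.

(* The set of states in which a run on [s] can arrive at the root. *)
Fixpoint reachable (Omega : rankedAlphabet) (A : tree_automaton Omega)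
    (s : term Omega) : {set astate A} :=
  match s with
  | Var _ => set0
  | App w ss =>
      let rs := map (reachable A) ss in
      [set p | [exists ps : (rk w).-tuple (astate A),
        transition ps p && all2 (fun p' (r : {set astate A}) => p' \in r) ps rs]]
  end.

Definition accepts (Omega : rankedAlphabet) (A : tree_automaton Omega)
    (s : term Omega) : Prop :=
  exists2 p, p \in reachable A s & p \in final A.

Definition regular (Omega : rankedAlphabet) (L : term Omega -> Prop) : Prop :=
  exists A : tree_automaton Omega,
    forall s, L s <-> is_tree s /\ accepts A s.

Definition dmt_fc_bimorphism (Sigma : rankedAlphabet)
    (tau : term Sigma -> term Sigma -> Prop) : Prop :=
  exists (Omega : rankedAlphabet) (L : term Omega -> Prop)
         (M1 M2 : dmt_sp Omega Sigma),
    [/\ regular L, finite_copying M1, finite_copying M2 &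
        forall t1 t2, tau t1 t2 <->
          exists s, [/\ L s, t1 = dmt_apply M1 s & t2 = dmt_apply M2 s]].

(* Main.v *)
From HB Require Import structures.
Require Import Defs.
From mathcomp Require Import all_boot finmap boolp.

(* From an MCFT-transducer G, let Omega be the set of rules of G, so that derivation
   trees form a regular language over Omega; a single macro tree transducer whose
   states are the nonterminals of G computes the components of the derived forests,
   and starting it in S_1 or S_2 gives the two transducers of the bimorphism. It is
   finite-copying because right-hand sides are uniquely labeled, so that every
   reachable state sequence is repetition-free.

   From a bimorphism, combine the two transducers into one on the disjoint union of
   their states. The big nonterminals are the triples (i, p, qs) of a child number, a
   state p of the automaton for the regular language and a reachable state sequence
   qs; such a triple generates the forests M_qs(s) for the trees s on which the
   automaton can reach p. Only productive automaton states may be used: a child on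
   which qs is empty leaves no trace in a rule of the grammar. *)

Set Implicit Arguments.
Unset Strict Implicit.
Unset Printing Implicit Defensive.

(** * Relabeling and substitution *)

Fixpoint term_map (A B : Type) (f : A -> B) (t : term A) : term B :=
  match t with
  | Var i => Var i
  | App a ts => App (f a) (map (term_map f) ts)
  end.

Definition sum_mapl (A B C : Type) (f : A -> B) (c : A + C) : B + C :=
  match c with inl a => inl (f a) | inr b => inr b end.

Definition lmap (A B C : Type) (f : A -> B) : term (A + C) -> term (B + C) :=
  term_map (sum_mapl f).

Lemma pmap_flatten (T U : Type) (f : T -> option U) (ss : seq (seq T)) :
  pmap f (flatten ss) = flatten (map (pmap f) ss).
Proof. by elim: ss => //= s ss IH; rewrite pmap_cat IH. Qed.

Lemma left_labels_inl (A B : Type) (a : A) (ts : seq (term (A + B))) :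
  left_labels (App (inl a) ts) = a :: flatten (map (@left_labels A B) ts).
Proof. by rewrite /left_labels /= pmap_flatten -map_comp. Qed.

Lemma left_labels_inr (A B : Type) (b : B) (ts : seq (term (A + B))) :
  left_labels (App (inr b) ts) = flatten (map (@left_labels A B) ts).
Proof. by rewrite /left_labels /= pmap_flatten -map_comp. Qed.

Definition left_labelsE := (left_labels_inl, left_labels_inr).

Section TermMap.
Variables (A B : Type) (f : A -> B).

Lemma labels_map (t : term A) : labels (term_map f t) = map f (labels t).
Proof.
elim/@term_nested_ind: t => //= a ts IH; congr cons.
by elim: ts IH => //= t ts IHts [-> /IHts ->]; rewrite map_cat.
Qed.

Lemma vars_map (t : term A) : vars (term_map f t) = vars t.
Proof.
by elim/@term_nested_ind: t => //= a ts; elim: ts => //= t ts IH [-> /IH ->].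
Qed.

End TermMap.

Lemma ranked_map (A B : rankedAlphabet) (f : A -> B) (t : term A) :
  {in labels t, forall a, rk (f a) = rk a} ->
  ranked (term_map f t) = ranked t.
Proof.
elim/@term_nested_ind: t => //= a ts IH Hf.
rewrite Hf ?mem_head // size_map; congr andb.
have {}Hf : {in flatten (map (@labels A) ts), forall a, rk (f a) = rk a}.
  by move=> b bts; apply: Hf; rewrite in_cons bts orbT.
elim: ts IH Hf => //= t ts IHts [Ht /IHts{}IHts] Hf.
by rewrite Ht ?IHts // => b bt; apply: Hf; rewrite mem_cat bt ?orbT.
Qed.

Lemma pattern_map (A B : rankedAlphabet) (f : A -> B) k (t : term A) :
  {in labels t, forall a, rk (f a) = rk a} ->
  pattern k (term_map f t) = pattern k t.
Proof. by move=> Hf; rewrite /pattern ranked_map // vars_map. Qed.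

Section LeftMap.
Variables (A B C : Type) (f : A -> B).

Lemma left_labels_lmap (t : term (A + C)) :
  left_labels (lmap f t) = map f (left_labels t).
Proof.
rewrite /left_labels labels_map.
by elim: (labels t) => //= -[a|c] l ->.
Qed.

Lemma subst_lmap (g : B -> term C) (t : term (A + C)) :
  subst g (lmap f t) = subst (g \o f) t.
Proof.
elim/@term_nested_ind: t => //= -[a|c] ts IH /=; rewrite -map_comp.
  by congr inst; elim: ts IH => //= t ts IHts [-> /IHts ->].
by congr App; elim: ts IH => //= t ts IHts [-> /IHts ->].
Qed.

(** The map [f] may send several symbols to one label, so equal labels of [t] can be lifted to
    different symbols. In one direction this attaches child numbers to nonterminals, in the other it
    turns repeated states into distinct nonterminals. *)
Definition liftable (t : term (B + C)) : Prop :=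
  forall cs, map f cs = left_labels t ->
  exists2 t', lmap f t' = t & left_labels t' = cs.

Lemma liftable_forest (ts : seq (term (B + C))) (cs : seq A) :
  foldr (fun t => and (liftable t)) True ts ->
  map f cs = flatten (map (@left_labels B C) ts) ->
  exists2 ts', map (lmap f) ts' = ts & flatten (map (@left_labels A C) ts') = cs.
Proof.
elim: ts cs => [|t ts IH] cs /=; first by case: cs => // _ _; exists [::].
(* The first [n] chosen symbols go to the first tree, the others to the remaining trees. *)
move=> [lift_t /IH{}IH] eq_cs; set n := size (left_labels t) in eq_cs *.
have /lift_t[t1 <- lab_t1] : map f (take n cs) = left_labels t.
  by rewrite map_take eq_cs take_size_cat.
have /IH[ts1 <- lab_ts1] :
    map f (drop n cs) = flatten (map (@left_labels B C) ts).
  by rewrite map_drop eq_cs drop_size_cat.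
by exists (t1 :: ts1); rewrite //= lab_t1 lab_ts1 cat_take_drop.
Qed.

Lemma lmap_lift (t : term (B + C)) : liftable t.
Proof.
elim/@term_nested_ind: t => [i [|//]|[b|c] ts IH cs]; first by exists (Var i).
  case: cs => [|a cs]; rewrite left_labelsE //= => -[<-] /(liftable_forest IH).
  by case=> ts' <- <-; exists (App (inl a) ts'); rewrite ?left_labelsE.
rewrite left_labelsE => /(liftable_forest IH)[ts' <- <-].
by exists (App (inr c) ts'); rewrite ?left_labelsE.
Qed.

Lemma lmap_lift_forest (ts : seq (term (B + C))) (cs : seq A) :
  map f cs = flatten (map (@left_labels B C) ts) ->
  exists2 ts', map (lmap f) ts' = ts & flatten (map (@left_labels A C) ts') = cs.
Proof.
by apply: liftable_forest; elim: ts => //= t ts IH; split=> //; apply: lmap_lift.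
Qed.

End LeftMap.

Lemma mem_left_labels (A B : eqType) (t : term (A + B)) (a : A) :
  (a \in left_labels t) = (inl a \in labels t).
Proof. by rewrite /left_labels; elim: (labels t) => //= -[b|b] l IH; rewrite !inE IH. Qed.

Lemma pattern_lmap (A B C : rankedAlphabet) (f : A -> B) k (t : term (A + C)%type) :
  {in left_labels t, forall a, rk (f a) = rk a} ->
  pattern k (lmap f t) = pattern k t.
Proof.
move=> Hf; rewrite /lmap.
by apply: (@pattern_map (A + C)%type (B + C)%type) => -[a|c] //;
  rewrite -mem_left_labels; apply: Hf.
Qed.

Lemma left_labels_inr_map (A C : Type) (t : term C) :
  left_labels (term_map (@inr A C) t) = [::].
Proof. by rewrite /left_labels labels_map; elim: (labels t). Qed.

Lemma eq_in_subst (A : eqType) (C : Type) (f g : A -> term C) (t : term (A + C)) :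
  {in left_labels t, f =1 g} -> subst f t = subst g t.
Proof.
suff eq_forest (ts : seq (term (A + C))) :
    foldr (fun t => and ({in left_labels t, f =1 g} -> subst f t = subst g t))
      True ts ->
    {in flatten (map (@left_labels A C) ts), f =1 g} ->
    map (subst f) ts = map (subst g) ts.
  elim/@term_nested_ind: t => // -[a|c] ts IH; rewrite left_labelsE => Hfg /=.
    rewrite Hfg ?mem_head // (eq_forest ts) // => b bts.
    by apply: Hfg; rewrite in_cons bts orbT.
  by rewrite (eq_forest ts).
elim: ts => //= t' ts IHts [IHt /IHts{}IHts] Hfg.
by rewrite IHt ?IHts // => b bt; apply: Hfg; rewrite mem_cat bt ?orbT.
Qed.

Lemma ranked_inst (A : rankedAlphabet) (ss : seq (term A)) (t : term A) :
  all (@ranked A) ss -> ranked t -> ranked (inst ss t).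
Proof.
move=> ss_ranked; elim/@term_nested_ind: t => [i _|a ts IH] /=.
  have [lt_i|ge_i] := ltnP i (size ss); last by rewrite nth_default.
  exact: (all_nthP (Var i) ss_ranked).
rewrite size_map => /andP[-> ts_ranked] /=.
by elim: ts IH ts_ranked => //= t ts IHts [Ht /IHts{}IHts] /andP[/Ht -> /IHts ->].
Qed.

Lemma vars_inst (A : Type) (ss : seq (term A)) (t : term A) :
  vars (inst ss t) = flatten [seq vars (nth (Var i) ss i) | i <- vars t].
Proof.
elim/@term_nested_ind: t => [i|a ts IH] /=; first by rewrite cats0.
by elim: ts IH => //= t ts IHts [-> /IHts ->]; rewrite map_cat flatten_cat.
Qed.

(** A pattern uses each of its variables exactly once, so every argument survives exactly once,
    possibly in another order. *)
Lemma vars_inst_pattern (A : rankedAlphabet) (ss : seq (term A)) (t : term A) :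
  pattern (size ss) t -> perm_eq (vars (inst ss t)) (flatten (map (@vars A) ss)).
Proof.
case/andP=> _ vars_t; rewrite vars_inst.
apply: perm_trans (perm_flatten (perm_map _ vars_t)) _.
rewrite (_ : map _ _ = map (@vars A) ss) //.
apply: (@eq_from_nth _ [::]) => [|i]; rewrite !size_map size_iota // => lt_i.
rewrite (nth_map 0) ?size_iota // (nth_map (Var i)) // nth_iota // add0n.
Qed.

Lemma pattern_subst (A C : rankedAlphabet) (f : A -> term C) k
    (t : term (A + C)%type) :
  pattern k t -> {in left_labels t, forall a, pattern (rk a) (f a)} ->
  pattern k (subst f t).
Proof.
move=> /andP[t_ranked t_vars] Hf.
(* The claim is freed of [k], because subtrees of a pattern are ranked but need not be patterns
   themselves. Linearity of each [f a] preserves the multiset of variables. *)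
suff [t'_ranked t'_vars] : ranked (subst f t) /\ perm_eq (vars (subst f t)) (vars t).
  by rewrite /pattern t'_ranked (perm_trans t'_vars).
elim/@term_nested_ind: t {k t_vars} t_ranked Hf => // c ts IH.
rewrite [ranked _]/= => /andP[/eqP size_ts ts_ranked] Hf.
have {}IH : all (@ranked C) (map (subst f) ts) /\
    perm_eq (flatten (map (@vars C) (map (subst f) ts)))
            (flatten (map (@vars _) ts)).
  have {}Hf : {in flatten (map (@left_labels A C) ts),
      forall a, pattern (rk a) (f a)}.
    by case: c Hf {size_ts} => [a|c] Hf b bts; apply: Hf;
      rewrite left_labelsE ?in_cons bts ?orbT.
  elim: ts IH ts_ranked Hf {size_ts} => //= t ts IHts [IHt /IHts{}IHts].
  case/andP=> /IHt{}IHt /IHts{}IHts Hf.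
  have [|-> /perm_cat cat_t] := IHt; first by move=> b bt; apply: Hf; rewrite mem_cat bt.
  have [|-> /cat_t //] := IHts.
  by move=> b bt; apply: Hf; rewrite mem_cat bt orbT.
case: IH => ss_ranked ss_vars; case: c Hf size_ts => [a|c] Hf size_ts /=.
  have Ha : pattern (size (map (subst f) ts)) (f a).
    by rewrite size_map size_ts; apply: Hf; rewrite left_labelsE mem_head.
  split; first by apply: ranked_inst => //; case/andP: Ha.
  exact: perm_trans (vars_inst_pattern Ha) ss_vars.
by rewrite size_map size_ts eqxx ss_ranked.
Qed.

Lemma is_tree_App (A : rankedAlphabet) (a : A) (ts : seq (term A)) :
  is_tree (App a ts) = (size ts == rk a) && all (@is_tree A) ts.
Proof.
rewrite /is_tree /pattern /= -andbA; congr andb.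
have perm_nil (s : seq nat) : perm_eq s [::] = (size s == 0).
  by apply/idP/idP => [/perm_size ->|/nilP ->].
elim: ts => //= t ts <-; rewrite !perm_nil size_cat addn_eq0.
by case: (ranked t) => //=; rewrite andbCA.
Qed.

(** The value stored at the first occurrence of [n] is [g n] whichever block contains it, so the
    positional lookup becomes a function of the symbol alone. *)
Lemma big_envE (N : eqType) (Sigma : Type) (Bs : seq (seq N))
    (f : seq N -> seq (term Sigma)) (g : N -> term Sigma) (n : N) :
  {in Bs, forall B, f B = map g B} -> n \in flatten Bs -> big_env Bs f n = g n.
Proof.
move=> Hf Hn; rewrite /big_env.
rewrite (_ : map f Bs = map (map g) Bs); last exact/eq_in_map.
by rewrite -map_flatten (nth_map n) ?index_mem // nth_index.
Qed.

Lemma mem_reachable (Omega : rankedAlphabet) (A : tree_automaton Omega)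
    (w : Omega) (ss : seq (term Omega)) (p : astate A) :
  reflect (exists2 ps : (rk w).-tuple (astate A), transition ps p &
      size ss = rk w /\ forall i : 'I_(rk w), tnth ps i \in reachable A (nth (Var 0) ss i))
    (p \in reachable A (App w ss)).
Proof.
rewrite /= inE; apply: (iffP existsP) => -[ps].
  case/andP=> tr; rewrite all2E => /andP[/eqP size_ss /all_nthP Hps].
  rewrite size_tuple size_map in size_ss.
  exists ps => //; split=> // i; have lt_i : i < size ss by rewrite -size_ss.
  have := Hps (tnth ps i, set0) i.
  rewrite size_zip size_map size_tuple -size_ss minnn ltn_ord => /(_ isT).
  rewrite nth_zip ?size_tuple ?size_map //= (nth_map (Var 0)) //.
  by rewrite -(tnth_nth _ ps i).
move=> tr [size_ss Hps]; exists ps; rewrite tr all2E size_tuple size_map size_ss eqxx.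
apply/(all_nthP (p, set0)) => i; rewrite size_zip size_tuple size_map size_ss minnn => lt_i.
rewrite nth_zip ?size_tuple ?size_map //= (nth_map (Var 0)) ?size_ss //.
by have := Hps (Ordinal lt_i); rewrite (tnth_nth p).
Qed.

(** * From grammars to bimorphisms *)

Lemma map_lift (T : eqType) (U : Type) (f : U -> T) (P : U -> Prop) (l : seq T) :
  {in l, forall x, exists2 y, f y = x & P y} ->
  exists2 l', map f l' = l & foldr (fun y => and (P y)) True l'.
Proof.
elim: l => [|x l IH] Hl; first by exists [::].
have [y yx Py] := Hl x (mem_head x l).
have [|l' <- Pl'] := IH; first by move=> z zl; apply: Hl; rewrite in_cons zl orbT.
by exists (y :: l'); rewrite /= ?yx.
Qed.

Lemma mem_foldr_and (T : eqType) (P : T -> Prop) (l : seq T) :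
  foldr (fun y => and (P y)) True l -> {in l, forall x, P x}.
Proof.
elim: l => //= x l IH [Px /IH{}IH] y.
by rewrite in_cons => /orP[/eqP ->|/IH].
Qed.

Lemma nth_flatten_uniq (T : eqType) (ss : seq (seq T)) (x : T) i j :
  uniq (flatten ss) -> x \in nth [::] ss i -> x \in nth [::] ss j -> i = j.
Proof.
elim: ss i j => [|s ss IH] [|i] [|j] //=; rewrite cat_uniq.
- case/and3P=> _ /hasPn/(_ x) Hx _ xs xj.
  have /Hx/negP[] // : x \in flatten ss.
  apply/flattenP; exists (nth [::] ss j) => //; apply: mem_nth.
  by rewrite ltnNge; apply: contraTN xj => /(nth_default _) ->.
- case/and3P=> _ /hasPn/(_ x) Hx _ xi xs.
  have /Hx/negP[] // : x \in flatten ss.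
  apply/flattenP; exists (nth [::] ss i) => //; apply: mem_nth.
  by rewrite ltnNge; apply: contraTN xi => /(nth_default _) ->.
- by case/and3P=> _ _ uss xi xj; congr S; apply: IH uss xi xj.
Qed.

Lemma uniq_flatten_map (T' U : eqType) (F : T' -> seq U) (l : seq T') :
  uniq l -> {in l, forall x, uniq (F x)} ->
  {in l &, forall x y z, z \in F x -> z \in F y -> x = y} ->
  uniq (flatten (map F l)).
Proof.
elim: l => //= x l IH /andP[x_l /IH{}IH] uniqF injF.
rewrite cat_uniq uniqF ?mem_head //= IH ?andbT.
- apply/hasPn => z /flatten_mapP[y yl zy]; apply: contra x_l => zx.
  by rewrite (injF x y _ _ z) ?mem_head // in_cons yl orbT.
- by move=> y yl; apply: uniqF; rewrite in_cons yl orbT.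
- by move=> y z yl zl; apply: injF; rewrite in_cons ?yl ?zl orbT.
Qed.

(** A repetition-free sequence has length at most [#|T|], so the tuples of lengths 0 to [#|T|]
    suffice. *)
Lemma finite_uniq (T : finType) :
  exists l : seq (seq T), forall s, uniq s -> s \in l.
Proof.
exists (flatten [seq [seq val t | t <- enum {: n.-tuple T}] | n <- iota 0 #|T|.+1]).
move=> s uniq_s; apply/flatten_mapP; exists (size s).
  by rewrite mem_iota ltnS -(card_uniqP uniq_s) max_card.
by apply/mapP; exists (in_tuple s); rewrite ?mem_enum.
Qed.

Lemma all2_map (S T : Type) (r : S -> T -> bool) (f : S -> T) (s : seq S) :
  all2 r s (map f s) = all (fun x => r x (f x)) s.
Proof. by elim: s => //= x s ->. Qed.

(** * Transducer and automaton on the derivation trees of a grammar *)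

Section GrammarToBimorphism.
Variables (Sigma : rankedAlphabet) (G : mcft_transducer Sigma).

Definition has_pattern k := `[< exists t : term Sigma, pattern k t >].

(* A transducer is total, so every state needs some right-hand side on every
   symbol, but there may be no pattern over [Sigma] of the rank of an
   unproductive nonterminal; such a nonterminal gets rank 1, for which the
   pattern x_1 always exists. *)
Definition grammar_state : Type := nonterminal G.
HB.instance Definition _ := Finite.on grammar_state.
HB.instance Definition _ := IsRanked.Build grammar_state
  (fun n : nonterminal G => if has_pattern (rk n) then rk n else 1).

(** The two identity maps select which of the two rank functions applies to the same symbol. *)
Definition state_of (n : nonterminal G) : grammar_state := n.
Definition nonterminal_of (n : grammar_state) : nonterminal G := n.

Definition rule_symbol : Type := rules G.
HB.instance Definition _ := Finite.on rule_symbol.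
Definition rule_lhs_of (r : rule_symbol) : seq grammar_state := (fsval r).1.1.
Definition rule_forest (r : rule_symbol) := (fsval r).1.2.
Definition rule_links_of (r : rule_symbol) : {fset seq (nonterminal G)} :=
  (fsval r).2.
(** In a derivation tree, the children of a node [r] are derivations of the links of [r], in the
    order in which the finite set lists them. *)
HB.instance Definition _ := IsRanked.Build rule_symbol
  (fun r => size (rule_links_of r)).

Lemma rule_symbol_wf (r : rule_symbol) :
  mcft_rule_wf (bigs G) (rule_lhs_of r) (rule_forest r) (rule_links_of r).
Proof. by case: r => -[[A u] L] r_rules; apply: rules_wf r_rules. Qed.

(** On such rules every nonterminal keeps its rank as a state. All rules used in derivations are of
    this kind, since there each of their nonterminals generates a pattern of its rank. *)
Definition realizable (r : rule_symbol) :=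
  all (fun n : nonterminal G => has_pattern (rk n))
    (rule_lhs_of r ++ forest_nonterminals (rule_forest r)).

Lemma rk_state_of (n : nonterminal G) :
  has_pattern (rk n) -> rk (state_of n) = rk n.
Proof. by move=> Hn; rewrite [LHS]/= /rk /= Hn. Qed.

Lemma state_pattern (n : grammar_state) : exists t : term Sigma, pattern (rk n) t.
Proof.
rewrite /rk /=; case: ifP => [/asboolP //|_].
by exists (Var 0).
Qed.

(** The right-hand side is the component of [n] in the forest of the rule, each nonterminal tagged
    with the position of the link that contains it. Where this makes no sense, a pattern without
    calls serves as a dummy. *)
Lemma grammar_rhs_ex (n : grammar_state) (r : rule_symbol) :
  exists t : term (call grammar_state (rk r) + Sigma)%type,
    pattern (rk n) t /\
    if realizable r && (n \in rule_lhs_of r) then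
      lmap (fun c => nonterminal_of c.1) t =
        nth (Var 0) (rule_forest r) (index n (rule_lhs_of r)) /\
      {in left_labels t, forall c : call grammar_state (rk r),
        nonterminal_of c.1 \in nth [::] (rule_links_of r) c.2}
    else left_labels t = [::].
Proof.
have [/andP[r_ok n_lhs]|_] := boolP (realizable r && (n \in rule_lhs_of r));
  last first.
  have [t t_pat] := state_pattern n.
  exists (term_map inr t); split; last exact: left_labels_inr_map.
  by rewrite (@pattern_map _ (call grammar_state (rk r) + Sigma)%type).
have wf := rule_symbol_wf r.
set t := nth _ _ _; have lt_j : index n (rule_lhs_of r) < size (rule_lhs_of r).
  by rewrite index_mem.
have := rule_rank wf; rewrite all2E => /andP[/eqP size_u u_pat].
have t_pat : pattern (rk (nonterminal_of n)) t.
  have := all_nthP (nonterminal_of n, Var 0) u_pat (index n (rule_lhs_of r)).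
  by rewrite size_zip -size_u minnn lt_j nth_zip //= nth_index //; apply.
have t_sub : {subset left_labels t <= forest_nonterminals (rule_forest r)}.
  move=> m mt; apply/flatten_mapP; exists t => //.
  by apply: mem_nth; rewrite -size_u.
have [|cs cs_t /mem_foldr_and cs_links] :=
    @map_lift _ (call grammar_state (rk r)) (fun c => nonterminal_of c.1)
      (fun c => nonterminal_of c.1 \in nth [::] (rule_links_of r) c.2) (left_labels t).
  move=> m /t_sub /(rule_links_cover wf)[B BL mB].
  have lt_B : index B (rule_links_of r) < rk r by rewrite index_mem.
  by exists (state_of m, Ordinal lt_B) => //=; rewrite nth_index.
have [t' t'_t t'_cs] := lmap_lift cs_t.
exists t'; rewrite t'_cs; split=> //.
have rk_ok m : m \in rule_lhs_of r ++ forest_nonterminals (rule_forest r) ->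
    rk (state_of m) = rk (nonterminal_of m).
  by move=> Hm; apply: rk_state_of; apply: (allP r_ok).
rewrite -(pattern_lmap (f := fun c : call grammar_state (rk r) => nonterminal_of c.1)).
  by rewrite t'_t [rk n]rk_ok // mem_cat n_lhs.
move=> c; rewrite t'_cs => ccs; rewrite [RHS](rk_ok c.1) //.
by rewrite mem_cat t_sub ?orbT // -cs_t; apply: map_f.
Qed.

Definition grammar_rhs n r := sval (cid (grammar_rhs_ex n r)).

Definition grammar_dmt (n : grammar_state) (rk_n : rk n = 0) :
    dmt_sp rule_symbol Sigma :=
  {| initial_rank := rk_n;
     rhs_pattern := fun n r => (svalP (cid (grammar_rhs_ex n r))).1 |}.

Lemma left_labels_grammar_rhs n r :
  map (fun c : call grammar_state (rk r) => nonterminal_of c.1) (left_labels (grammar_rhs n r)) =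
    if realizable r && (n \in rule_lhs_of r) then
      left_labels (nth (Var 0) (rule_forest r) (index n (rule_lhs_of r)))
    else [::].
Proof.
rewrite /grammar_rhs; case: cid => t /= [_]; case: ifP => [_ [<- _]|_ -> //].
by rewrite left_labels_lmap.
Qed.

(** Being repetition-free is an invariant of state sequences: distinct states select distinct
    components of the forest, which share no nonterminal, and no component repeats one. *)
Lemma grammar_dmt_finite_copying n (rk_n : rk n = 0) :
  finite_copying (grammar_dmt rk_n).
Proof.
have [l Hl] := finite_uniq grammar_state; exists l => qs sts_qs; apply: Hl.
elim: {qs} sts_qs => // r i qs _ uniq_qs.
have sub_labels q : subseq [seq c.1 | c <- left_labels (grammar_rhs q r) & c.2 == i]
    (map (fun c : call grammar_state (rk r) => nonterminal_of c.1) (left_labels (grammar_rhs q r))).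
  exact/map_subseq/filter_subseq.
have labels_nth q x : x \in [seq c.1 | c <- left_labels (grammar_rhs q r) & c.2 == i] ->
    q \in rule_lhs_of r /\
    x \in nth [::] (map (@left_labels _ _) (rule_forest r)) (index q (rule_lhs_of r)).
  move/(mem_subseq (sub_labels q)); rewrite left_labels_grammar_rhs.
  case: ifP => // /andP[_ q_lhs] Hx; split=> //.
  have := rule_rank (rule_symbol_wf r); rewrite all2E => /andP[/eqP size_u _].
  by rewrite (nth_map (Var 0)) // -size_u index_mem.
have uniq_u := rule_uniquely_labeled (rule_symbol_wf r).
apply: uniq_flatten_map => // [q _|q q' _ _ x].
  apply: subseq_uniq (sub_labels q) _; rewrite left_labels_grammar_rhs.
  case: ifP => // /andP[_ q_lhs]; apply: subseq_uniq uniq_u.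
  have := rule_rank (rule_symbol_wf r); rewrite all2E => /andP[/eqP size_u _].
  have lt_j : index q (rule_lhs_of r) < size (rule_forest r).
    by rewrite -size_u index_mem.
  (* The labels of one component form a subsequence of those of the whole forest. *)
  move: (index _ _) lt_j; elim: (rule_forest r) => //= t ts IH [_|j /IH] /=.
    exact: prefix_subseq.
  move=> /subseq_trans; apply; exact: suffix_subseq.
case/labels_nth=> q_lhs xq /labels_nth[q'_lhs xq'].
have := nth_flatten_uniq uniq_u xq xq'.
by move/(congr1 (nth q (rule_lhs_of r))); rewrite !nth_index.
Qed.

Variables (n0 : grammar_state) (rk_n0 : rk n0 = 0).
Local Notation eval := (@dmt_eval _ _ (grammar_dmt rk_n0)).

(** Links are disjoint, so a nonterminal determines its link; this makes the assignment of a rule a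
    function of single nonterminals, as in [big_envE]. *)
Definition link_of (r : rule_symbol) (n : nonterminal G) : seq (nonterminal G) :=
  nth [::] (rule_links_of r) (find (fun B => n \in B) (rule_links_of r)).

Lemma link_ofE (r : rule_symbol) B n :
  B \in rule_links_of r -> n \in B -> link_of r n = B.
Proof.
move=> BL nB; set p := fun C : seq (nonterminal G) => n \in C.
have has_p : has p (rule_links_of r) by apply/hasP; exists B.
have link_n : n \in link_of r n by apply: (nth_find [::] has_p).
have link_L : link_of r n \in rule_links_of r by rewrite mem_nth // -has_find.
apply: contraTeq nB => /(rule_links_disjoint (rule_symbol_wf r) link_L BL).
by move=> /disjointFr ->.
Qed.

(** One derivation step is one evaluation step: the child number in a call is the position of a
    link, so the transducer takes from that child what the grammar takes from that link. *)
Lemma eval_rule (r : rule_symbol) ss f :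
  realizable r -> size ss = rk r ->
  {in rule_links_of r, forall B,
    f B = map (eval (nth (Var 0) ss (index B (rule_links_of r)))) B} ->
  map (subst (big_env (rule_links_of r) f)) (rule_forest r) =
  map (eval (App r ss)) (rule_lhs_of r).
Proof.
move=> r_ok size_ss Hf; have wf := rule_symbol_wf r.
have := rule_rank wf; rewrite all2E => /andP[/eqP size_u _].
apply: (@eq_from_nth _ (Var 0)) => [|j]; rewrite !size_map // -size_u => lt_j.
rewrite (nth_map (Var 0)) -?size_u // (nth_map n0) //.
set n := nth n0 _ j; have n_lhs : n \in rule_lhs_of r by apply: mem_nth.
have j_n : j = index n (rule_lhs_of r).
  by rewrite index_uniq // (bigs_repetition_free (rule_lhs wf)).
rewrite /= /grammar_rhs; case: cid => t /= [_]; rewrite r_ok n_lhs /= -j_n.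
case=> <- t_links; rewrite subst_lmap; apply: eq_in_subst => c /t_links c_link.
have lt_c : c.2 < size (rule_links_of r) by apply: ltn_ord.
have cL := mem_nth [::] lt_c.
rewrite /= (big_envE (g := fun n =>
  eval (nth (Var 0) ss (index (link_of r n) (rule_links_of r))) n)).
- rewrite (link_ofE cL c_link) index_uniq ?fset_uniq //.
  by rewrite (nth_map (Var 0)) // size_ss.
- move=> B BL; rewrite Hf //; apply/eq_in_map => m mB.
  by rewrite (link_ofE BL mB).
- by apply/flattenP; exists (nth [::] (rule_links_of r) c.2).
Qed.

Definition grammar_automaton : tree_automaton (rule_symbol) := {|
  astate := bigs G;
  transition := fun r ps p =>
    [&& realizable r, fsval p == rule_lhs_of r &
        map (@fsval _ _) ps == rule_links_of r :> seq _];
  final := [set p | fsval p == [:: start1 G; start2 G]]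
|}.

Lemma reachable_language s p :
  p \in reachable grammar_automaton s ->
  mcft_language (fsval p) (map (eval s) (fsval p)).
Proof.
elim/@term_nested_ind: s p => [i|r ss /mem_foldr_and IH] p; first by rewrite inE.
case/mem_reachable=> ps /and3P[r_ok /eqP p_lhs /eqP ps_links] [size_ss Hps].
pose f B := map (eval (nth (Var 0) ss (index B (rule_links_of r)))) B.
rewrite p_lhs -(@eval_rule r ss f) //.
have Hf B : B \in rule_links_of r -> mcft_language B (f B).
  move=> BL; have lt_B : index B (rule_links_of r) < rk r by rewrite index_mem.
  rewrite /f; have {1 3}-> : B = fsval (tnth ps (Ordinal lt_B)).
    by rewrite (tnth_nth p) -(nth_map _ [::]) ?size_tuple // ps_links nth_index.
  apply: IH (Hps (Ordinal lt_B)).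
  by apply: mem_nth; rewrite size_ss.
move: {p_lhs ps_links Hps} f Hf; rewrite {IH size_ss r_ok}.
by case: r {ps} => -[[A u] L] r_rules f Hf; apply: mcft_language_rule r_rules Hf.
Qed.

(** The pattern property is proved along with the existence of a derivation tree, because it shows
    that the rule applied last is realizable. *)
Lemma language_reachable A t :
  mcft_language A t ->
  all2 (fun (a : nonterminal G) x => pattern (rk a) x) A t /\
  exists s p, [/\ is_tree s, p \in reachable grammar_automaton s,
    fsval p = A & t = map (eval s) A].
Proof.
elim=> {}A {t} u L f r_rules _ IH.
(* A derivation tree is chosen for each link, with [Var 0] as a default outside [L]. *)
have /choice[sB HsB] : forall B, exists s, B \in L -> exists p,
    [/\ is_tree s, p \in reachable grammar_automaton s,
      fsval p = B & f B = map (eval s) B].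
  move=> B; have [/IH[_ [s [p Hs]]]|_] := boolP (B \in L); last by exists (Var 0).
  by exists s => _; exists p.
pose r : rule_symbol := [` r_rules]%fset.
have wf : mcft_rule_wf (bigs G) A u L := rule_symbol_wf r.
have Hbig n B : B \in L -> n \in B -> pattern (rk n) (big_env L f n).
  move=> BL nB; rewrite (big_envE (g := fun n => eval (sB (link_of r n)) n)).
  - rewrite (@link_ofE r B) //; have [+ _] := IH B BL.
    by have [p [_ _ _ ->]] := HsB B BL; rewrite all2_map => /allP; apply.
  - move=> C CL; have [p [_ _ _ ->]] := HsB C CL.
    by apply/eq_in_map => m mC; rewrite (@link_ofE r C).
  - by apply/flattenP; exists B.
have pat : all2 (fun (a : nonterminal G) x => pattern (rk a) x) A
    (map (subst (big_env L f)) u).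
  have Hu : {subset forest_nonterminals u <= flatten L}.
    by move=> n /(rule_links_cover wf)[B BL nB]; apply/flattenP; exists B.
  have := rule_rank wf; move: Hu; rewrite /forest_nonterminals.
  elim: (A) u {wf r_rules r IH} => [|a A' IHA] [|t u] //= Hu /andP[t_pat u_pat].
  rewrite IHA // ?andbT; last by move=> n nu; apply: Hu; rewrite mem_cat nu orbT.
  apply: pattern_subst t_pat _ => n nt.
  have /flattenP[B BL nB] : n \in flatten L by apply: Hu; rewrite mem_cat nt.
  exact: Hbig BL nB.
split=> //.
have r_ok : realizable r.
  rewrite /realizable all_cat; apply/andP; split; apply/allP => n Hn; apply/asboolP.
    move: pat; rewrite all2E => /andP[/eqP size_A /(all_nthP (n, Var 0)) pat].
    exists (nth (Var 0) (map (subst (big_env L f)) u) (index n A)).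
    have lt_n : index n A < size A by rewrite index_mem.
    have := pat (index n A); rewrite size_zip -size_A minnn lt_n => /(_ isT).
    by rewrite nth_zip //= nth_index.
  have [B BL nB] := (rule_links_cover wf n).1 Hn.
  by exists (big_env L f n); apply: Hbig BL nB.
have lt_B B : B \in L -> index B L < size L by rewrite index_mem.
have lhs_A : A \in bigs G := rule_lhs wf.
exists (App r (map sB L)), [` lhs_A]%fset; split=> //.
- rewrite is_tree_App size_map eqxx /= all_map; apply/allP => B BL /=.
  by have [p []] := HsB B BL.
- have p_ex B : exists p : bigs G, B \in L ->
      p \in reachable grammar_automaton (sB B) /\ fsval p = B.
    have [BL|_] := boolP (B \in L); last by exists [` lhs_A]%fset.
    by have [p [_ ps pB _]] := HsB B BL; exists p.
  have [pB HpB] := choice p_ex.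
  have size_pB : size (map pB L) == rk r by rewrite size_map.
  apply/mem_reachable; exists (Tuple size_pB).
    rewrite /= r_ok eqxx /= -map_comp; apply/eqP.
    by apply: map_id_in => B /HpB[].
  rewrite size_map; split=> // i; have lt_i : i < size L by apply: ltn_ord.
  rewrite (tnth_nth [` lhs_A]%fset) /= !(nth_map [::]) //.
  exact: (HpB _ (mem_nth _ lt_i)).1.
- apply: (@eval_rule r) => // [|B BL]; first by rewrite size_map.
  have [p [_ _ _ ->]] := HsB B BL.
  by rewrite (nth_map [::]) ?index_mem // nth_index.
Qed.

End GrammarToBimorphism.

HB.instance Definition _ := IsRanked.Build void (fun=> 0).
HB.instance Definition _ := IsRanked.Build unit (fun=> 0).

(** If there is no tree over [Sigma], the initial nonterminals get rank 1 as states and cannot be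
    initial states. The empty relation is therefore treated apart, over the empty input alphabet,
    where no right-hand side has to be given. *)
Lemma empty_bimorphism (Sigma : rankedAlphabet)
    (tau : term Sigma -> term Sigma -> Prop) :
  (forall t1 t2, ~ tau t1 t2) -> dmt_fc_bimorphism tau.
Proof.
move=> no_tau.
pose M : dmt_sp void Sigma := @Build_dmt_sp void Sigma unit tt erefl
  (fun _ (w : void) => match w with end) (fun _ (w : void) => match w with end).
have M_fc : finite_copying M.
  by exists [:: [:: tt]] => qs [|[]]; rewrite inE.
exists void, (fun=> False), M, M; split=> //; last by split=> [/no_tau//|[s []]].
exists {| astate := void; transition := fun w : void => match w with end; final := set0 |}.
by move=> s; split=> // -[_ [[]]].
Qed.

Lemma mcft_transduction_bimorphism (Sigma : rankedAlphabet)
    (tau : term Sigma -> term Sigma -> Prop) :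
  (forall t1 t2, tau t1 t2 -> is_tree t1 /\ is_tree t2) ->
  mcft_transduction tau -> dmt_fc_bimorphism tau.
Proof.
move=> tau_tree [G tauE].
have [[t0 [t1 /tau_tree[t0_tree _]]]|no_tau] := pselect (exists t1 t2, tau t1 t2);
  last by apply: empty_bimorphism => t1 t2 t12; apply: no_tau; exists t1, t2.
have pat0 : has_pattern Sigma 0 by apply/asboolP; exists t0.
have [rk_S1 rk_S2] := start_rank G.
have rk1 : rk (state_of (start1 G)) = 0 by rewrite rk_state_of rk_S1.
have rk2 : rk (state_of (start2 G)) = 0 by rewrite rk_state_of rk_S2.
exists (rule_symbol G : rankedAlphabet),
  (fun s => is_tree s /\ accepts (grammar_automaton G) s),
  (grammar_dmt rk1), (grammar_dmt rk2); split.
- by exists (grammar_automaton G).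
- exact: grammar_dmt_finite_copying.
- exact: grammar_dmt_finite_copying.
- move=> u1 u2; rewrite tauE; split.
    (* Evaluation does not involve the initial state, so the values obtained with [rk1] are also
       those of the transducer built with [rk2]. *)
    case/(language_reachable rk1) => _ [s [p [s_tree ps p_start [-> ->]]]].
    exists s; split=> //; split=> //; exists p => //.
    by rewrite inE; apply/eqP.
  case=> s [[s_tree [p /(reachable_language rk1) p_lang]]].
  by rewrite inE => /eqP p_start -> ->; rewrite p_start in p_lang.
Qed.

(** * From bimorphisms to grammars *)

(** A call to child [i] is named by [i] and its position among the calls to [i], which is its
    position in the state sequence of that child. Equal calls thus get distinct names. *)
Lemma number_occurrences (T : Type) (I : eqType) (x0 : T) (ls : seq (T * I)) :
  let sub i := [seq c.1 | c <- ls & c.2 == i] in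
  exists js : seq (I * nat),
    [/\ ls = [seq (nth x0 (sub k.1) k.2, k.1) | k <- js], uniq js &
        forall k, (k \in js) = (k.2 < size (sub k.1))].
Proof.
(* Induction from the right: a new last call leaves the positions of the earlier ones unchanged. *)
elim/last_ind: ls => [|ls [x i] [js [ls_js uniq_js mem_js]]] sub; first by exists [::].
pose old j := [seq c.1 | c <- ls & c.2 == j].
have subE j : sub j = if j == i then rcons (old j) x else old j.
  rewrite /sub filter_rcons /= [j == i]eq_sym.
  by case: (i == j); rewrite ?map_rcons.
exists (rcons js (i, size (old i))); split=> [||[j n]].
- rewrite map_rcons /= subE eqxx nth_rcons ltnn eqxx {1}ls_js; congr rcons.
  apply/eq_in_map => -[j n]; rewrite mem_js /= subE => lt_n.
  by case: eqP => // _; rewrite nth_rcons lt_n.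
- by rewrite rcons_uniq uniq_js mem_js ltnn.
- rewrite mem_rcons in_cons mem_js /= subE xpair_eqE.
  by have [->|_] := eqVneq j i; rewrite /= ?size_rcons ?ltnS // [RHS]leq_eqVlt.
Qed.

Lemma inst_nil (A : Type) (t : term A) : inst [::] t = t.
Proof.
elim/@term_nested_ind: t => [i|a ts IH] /=; first by rewrite nth_nil.
by congr App; elim: ts IH => //= t ts IHts [-> /IHts ->].
Qed.

Lemma pattern_leaf (A B : rankedAlphabet) (a : A) :
  rk a = 0 -> pattern 0 (App (inl a) [::] : term (A + B)%type).
Proof.
by move=> rk_a; rewrite /pattern [ranked _]/= (rk_a : rk (inl a : (A + B)%type) = 0).
Qed.

(** * The grammar of one transducer with two start states *)

Section BimorphismToGrammar.
Variables (Omega Sigma : rankedAlphabet) (M : dmt_sp Omega Sigma).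
(** Here [M] stands for a disjoint union of two transducers with initial states [qa] and [qb];
    [side] tells their states apart and yields the partition of the nonterminals. *)
Variables (aut : tree_automaton Omega) (qa qb : state M) (side : pred (state M)).
Variable l : seq (seq (state M)).
Hypotheses (rk_qa : rk qa = 0) (rk_qb : rk qb = 0).
Hypotheses (side_qa : side qa) (side_qb : ~~ side qb).
Hypothesis side_rhs : forall q w (c : call (state M) (rk w)),
  c \in left_labels (rhs q w) -> side c.1 = side q.
Hypothesis initial_l : [:: qa; qb] \in l.
Hypothesis closed_l : forall w (i : 'I_(rk w)) qs, qs \in l -> state_sequence i qs \in l.

Local Notation eval := (@dmt_eval _ _ M).

(** Uniform bounds place child numbers and positions in fixed ordinals; the successors in
    ['I_max_rank.+1] and ['I_max_size.+1] make these nonempty, as [ord0] and [inord] require. *)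
Definition max_rank := \max_(w : Omega) rk w.
Definition max_size := \max_(qs <- l) size qs.

Definition big_symbol : Type := ('I_max_rank.+1 * astate aut * seq_sub l)%type.
Definition big_states (b : big_symbol) : seq (state M) := ssval b.2.

(* The big nonterminal (i, p, qs) generates the forests M_qs(s) for the trees s
   on which the automaton can reach p; the index i records of which child s is,
   which keeps distinct children disjoint. Its nonterminals are numbered
   by the positions in qs, because states may be repeated. [inl true] and
   [inl false] are the two initial nonterminals. *)
Definition grammar_nt : Type := (bool + big_symbol * 'I_max_size.+1)%type.
Definition nt_state (n : grammar_nt) : state M :=
  match n with
  | inl b => if b then qa else qb
  | inr (b, j) => nth qa (big_states b) j
  end.
Definition nt_index (n : grammar_nt) : 'I_max_rank.+1 :=
  match n with inl _ => ord0 | inr (b, _) => b.1.1 end.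
HB.instance Definition _ := Finite.on grammar_nt.
HB.instance Definition _ := IsRanked.Build grammar_nt (fun n => rk (nt_state n)).

Definition big_nts (b : big_symbol) : seq grammar_nt :=
  [seq inr (b, inord j) | j <- iota 0 (size (big_states b))].

Lemma big_states_size b : size (big_states b) <= max_size.
Proof. by apply: leq_bigmax_seq => //; apply: ssvalP. Qed.

Lemma mem_big_nts b c j :
  (inr (c, j) \in big_nts b) = (c == b) && (j < size (big_states b)).
Proof.
apply/mapP/andP => [[k + [-> ->]]|[/eqP -> lt_j]].
  rewrite mem_iota /= add0n => lt_k; rewrite eqxx inordK //.
  by rewrite ltnS (leq_trans (ltnW lt_k)) ?big_states_size.
by exists (nat_of_ord j); rewrite ?mem_iota ?inord_val.
Qed.

Lemma start_notin_big_nts b a : (inl a \in big_nts b) = false.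
Proof. by apply/mapP => -[]. Qed.

Lemma uniq_big_nts b : uniq (big_nts b).
Proof.
rewrite map_inj_in_uniq ?iota_uniq // => j k; rewrite !mem_iota /= !add0n.
move=> lt_j lt_k [/(congr1 (@nat_of_ord _))].
by rewrite !inordK // ltnS ?(leq_trans (ltnW lt_k)) ?(leq_trans (ltnW lt_j))
  ?big_states_size.
Qed.

Lemma map_nt_state b : map nt_state (big_nts b) = big_states b.
Proof.
rewrite -map_comp; apply: (@eq_from_nth _ qa); rewrite !size_map size_iota // => j lt_j.
rewrite (nth_map 0) ?size_iota // nth_iota //= inordK //.
by rewrite ltnS (leq_trans (ltnW lt_j)) ?big_states_size.
Qed.

Lemma nt_index_big b n : n \in big_nts b -> nt_index n = b.1.1.
Proof. by case/mapP=> j _ ->. Qed.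

Lemma big_nts_nil b : (big_nts b == [::]) = (big_states b == [::]).
Proof. by rewrite -!size_eq0 -(size_map (@nt_state)) map_nt_state. Qed.

(** A nonterminal carries its big symbol, so distinct big symbols give disjoint sequences. In
    particular the child number separates children with the same automaton state and state
    sequence. *)
Lemma big_nts_inj b c n : n \in big_nts b -> n \in big_nts c -> b = c.
Proof.
case/mapP=> j _ -> /mapP[k _ [->]] //.
Qed.

(** Calls with child numbers in the uniform range are a common target for nonterminals and for the
    calls of every input symbol, so that forests of both kinds can be compared. *)
Definition nt_call (n : grammar_nt) : call (state M) max_rank.+1 :=
  (nt_state n, nt_index n).

Lemma rk_max (w : Omega) : rk w <= max_rank.+1.
Proof. by rewrite leqW // /max_rank (leq_bigmax w). Qed.

Definition widen_call (w : Omega) (c : call (state M) (rk w)) :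
    call (state M) max_rank.+1 := (c.1, widen_ord (rk_max w) c.2).

Definition child (w : Omega) (ps : (rk w).-tuple (astate aut)) (b : big_symbol)
    (i : 'I_(rk w)) : big_symbol :=
  (widen_ord (rk_max w) i, tnth ps i, SeqSub (closed_l i (ssvalP b.2))).

Definition numbered_rhs (w : Omega) (ps : (rk w).-tuple (astate aut))
    (b : big_symbol) (u : seq (term (grammar_nt + Sigma))) : Prop :=
  [/\ map (lmap nt_call) u = [seq lmap (@widen_call w) (rhs q w) | q <- big_states b],
      uniq (forest_nonterminals u) &
      forall n, (n \in forest_nonterminals u) = [exists i, n \in big_nts (child ps b i)]].

(** The calls of all right-hand sides are numbered in a single list [ls], renamed to nonterminals in
    [cs], and put back into the trees by lifting along [nt_call]. *)
Lemma numbered_rhs_ex (w : Omega) (ps : (rk w).-tuple (astate aut)) (b : big_symbol) :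
  exists u, numbered_rhs ps b u.
Proof.
pose ls := flatten [seq left_labels (rhs q w) | q <- big_states b].
have subE i : [seq c.1 | c <- ls & c.2 == i] = big_states (child ps b i).
  rewrite /big_states /= /state_sequence /ls filter_flatten map_flatten -!map_comp.
  by congr flatten.
have [js [ls_js uniq_js mem_js]] := number_occurrences qa ls.
pose cs : seq grammar_nt := [seq inr (child ps b k.1, inord k.2) | k <- js].
(* Positions are below [max_size], so [inord] never falls back to its default. *)
have inord_js k : k \in js -> nat_of_ord (inord k.2 : 'I_max_size.+1) = k.2.
  rewrite mem_js subE => lt_k.
  by rewrite inordK // ltnS (leq_trans (ltnW lt_k)) ?big_states_size.
have cs_ls : map nt_call cs = map (@widen_call w) ls.
  rewrite [in RHS]ls_js -!map_comp; apply/eq_in_map => k kjs /=.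
  by rewrite /nt_call /widen_call /= inord_js // subE.
have [|u u_rhs u_cs] := @lmap_lift_forest _ _ Sigma nt_call
    [seq lmap (@widen_call w) (rhs q w) | q <- big_states b] cs.
  rewrite cs_ls /ls map_flatten -!map_comp; congr flatten.
  by apply: eq_map => q /=; rewrite left_labels_lmap.
exists u; rewrite /numbered_rhs /forest_nonterminals u_cs; split=> //.
  rewrite map_inj_in_uniq // => -[i m] [j n] im jn eq_nt.
  have -> : i = j.
    exact/val_inj/(congr1 (fun k => nat_of_ord (nt_index k)) eq_nt).
  have := congr1 (fun k : grammar_nt => if k is inr (_, o) then nat_of_ord o else 0) eq_nt.
  by rewrite /= (inord_js _ im) (inord_js _ jn) => /= ->.
move=> n; apply/mapP/existsP => [[k kjs ->]|[i]].
  exists k.1; rewrite mem_big_nts eqxx /=.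
  by rewrite inord_js // -subE -mem_js.
case/mapP=> j; rewrite mem_iota /= add0n -subE => lt_j ->.
by exists (i, j); rewrite ?mem_js.
Qed.


(** Since [nt_call] keeps the state of a nonterminal, hence its rank and side, both properties are
    inherited from the right-hand sides of [M]. *)
Lemma numbered_rhs_pattern_side (u : seq (term (grammar_nt + Sigma))) w b :
  map (lmap nt_call) u = [seq lmap (@widen_call w) (rhs q w) | q <- big_states b] ->
  all2 (fun n t => pattern (rk n) t &&
    all (fun m => side (nt_state m) == side (nt_state n)) (left_labels t)) (big_nts b) u.
Proof.
rewrite -map_nt_state -map_comp.
elim: (big_nts b) u => [|n ns IH] [|t u] //= [t_rhs /IH ->]; rewrite andbT.
apply/andP; split.
  rewrite -(pattern_lmap (f := nt_call)) // t_rhs.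
  by rewrite (pattern_lmap (f := @widen_call w)) //; apply: rhs_pattern.
apply/allP => m mt.
have : nt_call m \in left_labels (lmap nt_call t).
  by rewrite left_labels_lmap map_f.
by rewrite t_rhs left_labels_lmap => /mapP[c /side_rhs <- [-> _]].
Qed.

(** A child with empty state sequence would give the empty sequence, which is no big nonterminal. *)
Definition rule_links_set (w : Omega) (ps : (rk w).-tuple (astate aut)) b :
    {fset seq grammar_nt} :=
  [fset B in [seq big_nts (child ps b i) | i <- enum 'I_(rk w)] | B != [::]]%fset.

Lemma mem_rule_links w (ps : (rk w).-tuple (astate aut)) b B :
  reflect (exists2 i, B = big_nts (child ps b i) & B != [::])
    (B \in rule_links_set ps b).
Proof.
rewrite !inE /=; apply: (iffP andP) => [[/mapP[i _ ->] nz]|[i -> nz]].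
  by exists i.
by split=> //; apply: map_f; rewrite mem_enum.
Qed.

Definition productive (p : astate aut) : bool :=
  `[< exists2 s, is_tree s & p \in reachable aut s >].

Definition grammar_rule w (ps : (rk w).-tuple (astate aut)) b :
    mcft_rule grammar_nt Sigma :=
  (big_nts b, sval (cid (numbered_rhs_ex ps b)), rule_links_set ps b).

Definition start_big (p : astate aut) : big_symbol :=
  (ord0, p, SeqSub initial_l).

(** The nonterminals of [start_big p] may occur in right-hand sides, since 0 is a genuine child
    number. Hence there are separate initial nonterminals, with one rule for each final state. *)
Definition start_rule p : mcft_rule grammar_nt Sigma :=
  ([:: inl true; inl false],
   [seq App (inl n) [::] | n <- big_nts (start_big p)],
   [fset big_nts (start_big p)]%fset).

Definition valid_rule w (ps : (rk w).-tuple (astate aut)) (b : big_symbol) :=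
  [&& transition ps b.1.2, all productive ps & big_states b != [::]].

Definition grammar_rules : {fset mcft_rule grammar_nt Sigma} :=
  [fset x in [seq start_rule p | p <- enum (final aut)] ++
    flatten [seq [seq grammar_rule x.1 x.2 |
        x <- enum {: (rk w).-tuple (astate aut) * big_symbol} & valid_rule x.1 x.2]
      | w <- enum {: Omega}]]%fset.

Lemma mem_grammar_rules x :
  x \in grammar_rules <->
  (exists2 p, p \in final aut & x = start_rule p) \/
  (exists w (ps : (rk w).-tuple (astate aut)) b,
    valid_rule ps b /\ x = grammar_rule ps b).
Proof.
rewrite !inE /=; split=> [/orP[/mapP[p]|/flatten_mapP[w _ /mapP[[ps b]]]]|].
- by rewrite mem_enum => p_final ->; left; exists p.
- by rewrite mem_filter => /andP[ok _] ->; right; exists w, ps, b.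
case=> [[p p_final ->]|[w [ps [b [ok ->]]]]]; apply/orP.
  by left; apply: map_f; rewrite mem_enum.
right; apply/flatten_mapP; exists w; first by rewrite mem_enum.
by apply/mapP; exists (ps, b); rewrite // mem_filter ok mem_enum.
Qed.

Definition grammar_bigs : {fset seq grammar_nt} :=
  [fset B in [:: inl true; inl false] :: [seq big_nts b | b <- enum {: big_symbol}] |
    B != [::]]%fset.

Lemma mem_grammar_bigs B :
  B \in grammar_bigs <->
  B = [:: inl true; inl false] \/ exists2 b, B = big_nts b & B != [::].
Proof.
rewrite !inE /=; split=> [/andP[/orP[/eqP ->|/mapP[b _ ->] nz]]|[->|[b -> nz]]] //.
- by left.
- by right; exists b.
- by rewrite nz andbT map_f ?orbT // mem_enum.
Qed.

Lemma start_big_nts p : exists j k : 'I_max_size.+1,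
  [/\ big_nts (start_big p) = [:: inr (start_big p, j); inr (start_big p, k)],
    nt_state (inr (start_big p, j)) = qa & nt_state (inr (start_big p, k)) = qb].
Proof.
have := map_nt_state (start_big p); rewrite /big_nts /=.
by exists (inord 0), (inord 1); case: H.
Qed.

Lemma start_forest_nonterminals (B : seq grammar_nt) :
  forest_nonterminals [seq App (inl n) [::] : term (grammar_nt + Sigma) | n <- B] = B.
Proof. by rewrite /forest_nonterminals -map_comp; elim: B => //= n B ->. Qed.

Lemma grammar_rulesP A u L :
  (A, u, L) \in grammar_rules ->
  (exists2 p, p \in final aut &
    [/\ A = [:: inl true; inl false], u = [seq App (inl n) [::] | n <- big_nts (start_big p)]
      & L = [fset big_nts (start_big p)]%fset]) \/
  (exists w (ps : (rk w).-tuple (astate aut)) b,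
    [/\ valid_rule ps b, A = big_nts b, numbered_rhs ps b u & L = rule_links_set ps b]).
Proof.
case/mem_grammar_rules=> [[p p_final [-> -> ->]]|[w [ps [b [ok [-> -> ->]]]]]].
  by left; exists p.
by right; exists w, ps, b; split=> //; apply: svalP.
Qed.

Lemma grammar_rule_wf A u L :
  (A, u, L) \in grammar_rules -> mcft_rule_wf grammar_bigs A u L.
Proof.
case/grammar_rulesP=> [[p p_final [-> -> ->]]|].
  have [j [k [B_eq st_j st_k]]] := start_big_nts p.
  split; rewrite ?start_forest_nonterminals ?uniq_big_nts //.
  - by apply/mem_grammar_bigs; left.
  - have rk_j : rk (inr (start_big p, j) : grammar_nt) = 0 by rewrite -rk_qa -st_j.
    have rk_k : rk (inr (start_big p, k) : grammar_nt) = 0 by rewrite -rk_qb -st_k.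
    rewrite B_eq /= (_ : rk (inl true : grammar_nt) = 0) //.
    by rewrite (_ : rk (inl false : grammar_nt) = 0) // (pattern_leaf _ rk_j) pattern_leaf.
  - move=> B; rewrite inE => /eqP ->; apply/mem_grammar_bigs; right.
    by exists (start_big p); rewrite ?big_nts_nil.
  - by move=> B B'; rewrite !inE => /eqP -> /eqP ->; rewrite eqxx.
  - move=> n; split=> [nB|[B]]; last by rewrite inE => /eqP ->.
    by exists (big_nts (start_big p)); rewrite ?fset11.
case=> w [ps [b [/and3P[_ _ b_nz] -> [u_rhs u_uniq u_mem] ->]]]; split=> //.
- by apply/mem_grammar_bigs; right; exists b; rewrite ?big_nts_nil.
- have := numbered_rhs_pattern_side u_rhs; rewrite !all2E => /andP[-> /=].
  by apply: sub_all => x /andP[].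
- by move=> B /mem_rule_links[i -> nz]; apply/mem_grammar_bigs; right; exists (child ps b i).
- move=> B B' /mem_rule_links[i -> _] /mem_rule_links[j -> _].
  apply: contraNT => /pred0Pn[n /= /andP[ni nj]].
  by rewrite (big_nts_inj ni nj).
- move=> n; rewrite u_mem; split=> [/existsP[i ni]|[B /mem_rule_links[i -> _] ni]].
    exists (big_nts (child ps b i)) => //; apply/mem_rule_links; exists i => //.
    by apply: contraTneq ni => ->.
  by apply/existsP; exists i.
Qed.

Lemma grammar_start_not_in_rhs A u L a :
  (A, u, L) \in grammar_rules -> inl a \notin forest_nonterminals u.
Proof.
move/grammar_rulesP=> [[p _ [_ -> _]]|[w [ps [b [_ _ [_ _ u_mem] _]]]]].
  by rewrite start_forest_nonterminals start_notin_big_nts.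
by rewrite u_mem; apply/existsP => -[i]; rewrite start_notin_big_nts.
Qed.

Lemma grammar_side A u L a t :
  (A, u, L) \in grammar_rules -> (a, t) \in zip A u ->
  {in left_labels t, forall m, side (nt_state m) = side (nt_state a)}.
Proof.
move/grammar_rulesP=> [[p _ [-> -> _]]|[w [ps [b [_ -> [u_rhs _ _] _]]]]].
  have [j [k [-> st_j st_k]]] := start_big_nts p.
  rewrite /= !inE => /orP[] /eqP[-> ->] m; rewrite left_labelsE inE => /eqP ->.
    by rewrite st_j.
  by rewrite st_k.
have := numbered_rhs_pattern_side u_rhs; rewrite all2E => /andP[_ /allP H] /H /=.
by case/andP=> _ /allP Ht m /Ht /eqP.
Qed.

Hypothesis output : exists a : Sigma, 0 < rk a.

Lemma grammar_bigs_occ A A' :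
  A \in grammar_bigs -> A' \in grammar_bigs -> A =i A' -> A = A'.
Proof.
move/mem_grammar_bigs=> [->|[b -> nz]] /mem_grammar_bigs[->|[c -> nz']] // eqA.
- by have := eqA (inl true); rewrite start_notin_big_nts.
- by have := eqA (inl true); rewrite start_notin_big_nts.
- have [n nb] : exists n, n \in big_nts b.
    by case: (big_nts b) nz => // n s _; exists n; rewrite mem_head.
  by rewrite (@big_nts_inj b c n) // -eqA.
Qed.

(** Kept transparent, because later statements identify its nonterminals and rules with [grammar_nt]
    and [grammar_rules] by computation. *)
Definition bimorphism_grammar : mcft_transducer Sigma.
refine {|
  nonterminal := grammar_nt; bigs := grammar_bigs; rules := grammar_rules;
  start1 := inl true; start2 := inl false;
  output_alphabet := output;
  bigs_occ := grammar_bigs_occ;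
  rules_wf := grammar_rule_wf
|}.
- by move=> A /mem_grammar_bigs[->|[b _]].
- by move=> A /mem_grammar_bigs[->|[b -> _]] //; apply: uniq_big_nts.
- by apply/mem_grammar_bigs; left.
- by split; [apply: rk_qa|apply: rk_qb].
- by move=> A u L Hr; split; apply: grammar_start_not_in_rhs Hr.
- exists [set n | side (nt_state n)], [set n | ~~ side (nt_state n)]; split.
  + by apply/setP => n; rewrite !inE orbN.
  + by rewrite -setI_eq0; apply/eqP/setP => n; rewrite !inE andbN.
  + by rewrite inE.
  + by rewrite inE.
  + move=> A u L Hr a t aut_t; split; rewrite inE => Ha m mt; rewrite inE;
      by rewrite (grammar_side Hr aut_t mt).
Defined.

(** * Correctness of the constructed grammar *)

Local Notation language := (@mcft_language Sigma bimorphism_grammar).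

(** The intended value of [n] below a node with subtrees [ss]. As [n] carries its child number, one
    function serves all links of a rule. *)
Definition nt_eval (ss : seq (term Omega)) (n : grammar_nt) : term Sigma :=
  nth (fun=> Var 0) (map eval ss) (nt_index n) (nt_state n).

Lemma nt_eval_child (w : Omega) (ps : (rk w).-tuple (astate aut)) b ss (i : 'I_(rk w)) :
  size ss = rk w ->
  map (nt_eval ss) (big_nts (child ps b i)) =
  map (eval (nth (Var 0) ss i)) (state_sequence i (big_states b)).
Proof.
move=> size_ss; rewrite -[state_sequence _ _]/(big_states (child ps b i)).
rewrite -map_nt_state -map_comp; apply/eq_in_map => n /nt_index_big n_i.
by rewrite /nt_eval n_i /= (nth_map (Var 0)) // size_ss.
Qed.

(** Relabeled by [nt_call], the forest [u] is the sequence of right-hand sides with widened calls,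
    and both substitutions become the substitution of [h] in it. *)
Lemma eval_numbered_rhs (w : Omega) (ps : (rk w).-tuple (astate aut)) b u ss f :
  numbered_rhs ps b u ->
  {in rule_links_set ps b, forall B, f B = map (nt_eval ss) B} ->
  map (subst (big_env (rule_links_set ps b) f)) u =
  map (eval (App w ss)) (big_states b).
Proof.
move=> [u_rhs _ u_mem] Hf.
pose h (c : call (state M) max_rank.+1) : term Sigma :=
  nth (fun=> Var 0) (map eval ss) c.2 c.1.
transitivity (map (subst h) (map (lmap nt_call) u)).
  rewrite -map_comp; apply/eq_in_map => t tu /=; rewrite subst_lmap.
  apply: eq_in_subst => n nt; apply: big_envE => //.
  have : n \in forest_nonterminals u by apply/flatten_mapP; exists t.
  rewrite u_mem => /existsP[i ni]; apply/flattenP; exists (big_nts (child ps b i)) => //.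
  by apply/mem_rule_links; exists i => //; apply: contraTneq ni => ->.
by rewrite u_rhs -map_comp; apply: eq_map => q /=; rewrite subst_lmap.
Qed.

Lemma reachable_big_language s :
  is_tree s -> forall b, b.1.2 \in reachable aut s -> big_states b != [::] ->
  language (big_nts b) (map (eval s) (big_states b)).
Proof.
elim/@term_nested_ind: s => [i|w ss /mem_foldr_and IH]; first by case/andP=> _ /perm_size.
rewrite is_tree_App => /andP[/eqP size_ss /allP ss_tree] b.
case/mem_reachable=> ps ps_tr [_ ss_ps] b_nz.
have ok : valid_rule ps b.
  (* The subtrees of the input witness that the states [ps] are productive. *)
  rewrite /valid_rule ps_tr b_nz andbT; apply/all_tnthP => i; apply/asboolP.
  exists (nth (Var 0) ss i); last exact: ss_ps.
  by apply: ss_tree; rewrite mem_nth ?size_ss.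
have Hr : grammar_rule ps b \in grammar_rules.
  by apply/mem_grammar_rules; right; exists w, ps, b.
have u_num := svalP (cid (numbered_rhs_ex ps b)).
rewrite -(@eval_numbered_rhs w ps b _ ss (map (nt_eval ss)) u_num) //.
apply: (@mcft_language_rule Sigma bimorphism_grammar _ _ _ _ Hr).
move=> _ /mem_rule_links[i -> nz]; rewrite nt_eval_child //.
have ss_i : nth (Var 0) ss i \in ss by rewrite mem_nth ?size_ss.
by apply: (IH _ ss_i (ss_tree _ ss_i) (child ps b i)); [apply: ss_ps|rewrite -big_nts_nil].
Qed.

Lemma big_language_reachable A t :
  language A t -> exists2 s, is_tree s &
  (exists b, [/\ A = big_nts b, b.1.2 \in reachable aut s & t = map (eval s) (big_states b)]) \/
  [/\ A = [:: inl true; inl false], accepts aut s & t = [:: eval s qa; eval s qb]].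
Proof.
elim=> {}A {t} u L f.
case/grammar_rulesP=> [[p p_final [-> -> ->]]|].
  set B := big_nts _ => _ /(_ B); rewrite inE eqxx => /(_ isT)[s s_tree Hs].
  exists s => //; right.
  have B_nz : B != [::] by rewrite big_nts_nil.
  case: Hs => [[b [Bb ps fB]]|[B_start]]; last first.
    by have := start_notin_big_nts (start_big p) true; rewrite -/B B_start.
  (* As [B] is nonempty, its first nonterminal determines the big symbol. *)
  have eq_b : start_big p = b.
    case E: B B_nz => [//|n B'] _; apply: (@big_nts_inj _ _ n).
      by rewrite -/B E mem_head.
    by rewrite -Bb E mem_head.
  split=> //; first by exists p => //; rewrite -eq_b in ps.
  rewrite -/B -[RHS]/(map (eval s) (big_states (start_big p))) -map_nt_state.
  rewrite -(map_comp (eval s) nt_state) -(map_comp (subst _) (fun m => App (inl m) [::])).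
  apply/eq_in_map => n nB /=; rewrite inst_nil.
  apply: (big_envE (g := eval s \o nt_state)).
    by move=> C; rewrite inE => /eqP ->; rewrite fB -eq_b -map_nt_state -map_comp.
  by apply/flattenP; exists B; rewrite ?fset11.
case=> w [ps [b [/and3P[ps_tr ps_prod b_nz] -> u_num ->]]] _ IH.
(* Every child needs a subtree: a link supplies one by induction, and a child without link takes any
   tree showing that its automaton state is productive. *)
have /choice[sf Hsf] (i : 'I_(rk w)) : exists s,
    [/\ is_tree s, tnth ps i \in reachable aut s &
      big_nts (child ps b i) \in rule_links_set ps b ->
      f (big_nts (child ps b i)) = map (eval s) (state_sequence i (big_states b))].
  have [iL|_] := boolP (big_nts (child ps b i) \in rule_links_set ps b); last first.
    by have /all_tnthP/(_ i)/asboolP[s s_tree s_i] := ps_prod; exists s.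
  have [s s_tree [[c [c_i sc fc]]|[c_start]]] := IH _ iL; last first.
    by have := start_notin_big_nts (child ps b i) true; rewrite c_start.
  have eq_c : child ps b i = c.
    have /mem_rule_links[_ _] := iL.
    case E: (big_nts (child ps b i)) => [//|n B'] _; apply: (@big_nts_inj _ _ n).
      by rewrite E mem_head.
    by rewrite -c_i E mem_head.
  by exists s; split=> //; rewrite ?fc -eq_c // in sc *.
pose ss := [seq sf i | i <- enum 'I_(rk w)].
have size_ss : size ss = rk w by rewrite size_map size_enum_ord.
have ss_i (i : 'I_(rk w)) : nth (Var 0) ss i = sf i.
  by rewrite (nth_map i) ?size_enum_ord // nth_ord_enum.
exists (App w ss).
  rewrite is_tree_App size_ss eqxx /= all_map; apply/allP => i _ /=.
  by have [] := Hsf i.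
left; exists b; split=> //.
  apply/mem_reachable; exists ps => //; split=> // i.
  by rewrite ss_i; have [] := Hsf i.
apply: eval_numbered_rhs => // B BL; have /mem_rule_links[i Bi nz] := BL.
rewrite Bi nt_eval_child // ss_i; rewrite Bi in BL.
by have [_ _ ->] := Hsf i.
Qed.

Lemma bimorphism_grammarP t1 t2 :
  language [:: inl true; inl false] [:: t1; t2] <->
  exists s, [/\ is_tree s, accepts aut s, t1 = eval s qa & t2 = eval s qb].
Proof.
split=> [/big_language_reachable[s s_tree [[b [b_start]]|[_ s_acc [-> ->]]]]|].
- by have := start_notin_big_nts b true; rewrite -b_start.
- by exists s.
case=> s [s_tree [p ps p_final] -> ->].
have Hr : start_rule p \in grammar_rules.
  by apply/mem_grammar_rules; left; exists p.
pose f := map (eval s \o nt_state).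
rewrite (_ : [:: _; _] = map (subst (big_env [fset big_nts (start_big p)]%fset f))
    [seq App (inl n) [::] | n <- big_nts (start_big p)]).
  apply: (@mcft_language_rule Sigma bimorphism_grammar _ _ _ _ Hr) => B.
  rewrite inE => /eqP ->; rewrite /f map_comp map_nt_state.
  exact: reachable_big_language.
rewrite -[LHS]/(map (eval s) (big_states (start_big p))) -map_nt_state.
  rewrite -(map_comp (eval s) nt_state) -(map_comp (subst _) (fun m => App (inl m) [::])).
apply/eq_in_map => n nB /=; rewrite inst_nil (big_envE (g := eval s \o nt_state)) //.
by apply/flattenP; exists (big_nts (start_big p)); rewrite ?fset11.
Qed.

End BimorphismToGrammar.

(** * The disjoint union of two transducers *)

Section SumTransducer.
Variables (Omega Sigma : rankedAlphabet) (M1 M2 : dmt_sp Omega Sigma).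

Local Notation sum_state := (state M1 + state M2)%type.

Definition call_inl (w : Omega) (c : call (state M1) (rk w)) : call sum_state (rk w) :=
  (inl c.1, c.2).
Definition call_inr (w : Omega) (c : call (state M2) (rk w)) : call sum_state (rk w) :=
  (inr c.1, c.2).

Definition sum_rhs (q : sum_state) (w : Omega) :
    term (call sum_state (rk w) + Sigma) :=
  match q with
  | inl q1 => lmap (@call_inl w) (rhs q1 w)
  | inr q2 => lmap (@call_inr w) (rhs q2 w)
  end.

Lemma sum_rhs_pattern (q : sum_state) w : pattern (rk q) (sum_rhs q w).
Proof.
case: q => q /=.
  by rewrite (pattern_lmap (f := @call_inl w)) //; apply: rhs_pattern.
by rewrite (pattern_lmap (f := @call_inr w)) //; apply: rhs_pattern.
Qed.

(** Only one state can be declared initial; the outputs of [M2] are obtained by evaluating from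
    [inr (initial M2)]. *)
Definition sum_dmt : dmt_sp Omega Sigma :=
  @Build_dmt_sp Omega Sigma sum_state (inl (initial M1)) (initial_rank M1)
    sum_rhs sum_rhs_pattern.

Lemma nth_eval (M M' : dmt_sp Omega Sigma) (f : state M -> state M') ss k q :
  foldr (fun s => and (forall q, @dmt_eval _ _ M' s (f q) = @dmt_eval _ _ M s q))
    True ss ->
  nth (fun=> Var 0) (map (@dmt_eval _ _ M') ss) k (f q) =
  nth (fun=> Var 0) (map (@dmt_eval _ _ M) ss) k q.
Proof.
by elim: ss k => [|s ss IH] [|k] //= [eval_s /IH].
Qed.

Lemma eval_sum_inl s q : @dmt_eval _ _ sum_dmt s (inl q) = @dmt_eval _ _ M1 s q.
Proof.
elim/@term_nested_ind: s q => //= w ss IH q; rewrite subst_lmap.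
by apply: eq_in_subst => c _ /=; apply: (@nth_eval M1 sum_dmt inl).
Qed.

Lemma eval_sum_inr s q : @dmt_eval _ _ sum_dmt s (inr q) = @dmt_eval _ _ M2 s q.
Proof.
elim/@term_nested_ind: s q => //= w ss IH q; rewrite subst_lmap.
by apply: eq_in_subst => c _ /=; apply: (@nth_eval M2 sum_dmt inr).
Qed.

(** Calls never leave their summand, so sequences with all [M1]-states first keep this form. *)
Lemma sum_state_sequence (w : Omega) (i : 'I_(rk w)) qs1 qs2 :
  @state_sequence _ _ sum_dmt w i (map inl qs1 ++ map inr qs2) =
  map inl (state_sequence i qs1) ++ map inr (state_sequence i qs2).
Proof.
rewrite /state_sequence map_cat flatten_cat !map_flatten -!map_comp.
congr (flatten _ ++ flatten _); apply: eq_map => q /=;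
  by rewrite left_labels_lmap filter_map -!map_comp.
Qed.

Definition left_state (q : sum_state) := if q is inl _ then true else false.

Lemma left_state_rhs (q : state sum_dmt) (w : Omega) (c : call (state sum_dmt) (rk w)) :
  c \in left_labels (rhs q w) -> left_state c.1 = left_state q.
Proof. by case: q => q /=; rewrite left_labels_lmap => /mapP[d _ ->]. Qed.

(** The concatenations of a reachable sequence of [M1] with one of [M2] form a closed set. The given
    lists are first filtered, since they may contain unreachable sequences and then need not be
    closed. *)
Lemma sts_sum_finite :
  finite_copying M1 -> finite_copying M2 ->
  exists2 l : seq (seq (state sum_dmt)), [:: inl (initial M1); inr (initial M2)] \in l &
    forall (w : Omega) (i : 'I_(rk w)) qs, qs \in l -> state_sequence i qs \in l.
Proof.
move=> [l1 Hl1] [l2 Hl2].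
have mem_sts (M : dmt_sp Omega Sigma) l qs : (forall qs, sts qs -> qs \in l) ->
    reflect (@sts _ _ M qs) (qs \in [seq qs <- l | `[< sts qs >]]).
  move=> Hl; rewrite mem_filter; apply: (iffP andP) => [[/asboolP]//|Hqs].
  by split; [apply/asboolP|apply: Hl].
exists [seq map inl qs1 ++ map inr qs2 | qs1 <- [seq qs <- l1 | `[< sts qs >]],
                                        qs2 <- [seq qs <- l2 | `[< sts qs >]]].
  apply/allpairsP; exists ([:: initial M1], [:: initial M2]); split=> //=.
    by apply/mem_sts => //; apply: sts_initial.
  by apply/mem_sts => //; apply: sts_initial.
move=> w i _ /allpairsP[[qs1 qs2] [/(mem_sts _ _ _ Hl1) s1 /(mem_sts _ _ _ Hl2) s2 ->]].
rewrite sum_state_sequence; apply/allpairsP.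
exists (state_sequence i qs1, state_sequence i qs2); split=> //=.
  by apply/mem_sts => //; apply: sts_step.
by apply/mem_sts => //; apply: sts_step.
Qed.

End SumTransducer.

Lemma bimorphism_mcft_transduction (Sigma : rankedAlphabet)
    (tau : term Sigma -> term Sigma -> Prop) :
  (exists a : Sigma, 0 < rk a) ->
  dmt_fc_bimorphism tau -> mcft_transduction tau.
Proof.
move=> output [Omega [L [M1 [M2 [[aut L_aut] fc1 fc2 tauE]]]]].
have [l init_l closed_l] := sts_sum_finite fc1 fc2.
have left_init : ~~ left_state (inr (initial M2) : state M1 + state M2) by [].
exists (bimorphism_grammar aut (initial_rank M1 : rk (inl _ : state (sum_dmt M1 M2)) = 0)
  (initial_rank M2 : rk (inr _ : state (sum_dmt M1 M2)) = 0) isT left_init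
  (@left_state_rhs _ _ M1 M2) init_l closed_l output) => t1 t2.
rewrite tauE; split=> [[s [/L_aut[s_tree s_acc] -> ->]]|].
  by apply/bimorphism_grammarP; exists s; rewrite eval_sum_inl eval_sum_inr.
case/bimorphism_grammarP=> s; rewrite eval_sum_inl eval_sum_inr => -[s_tree s_acc -> ->].
by exists s; split=> //; apply/L_aut.
Qed.

Theorem theorem81 (Sigma : rankedAlphabet) (hSigma : exists a : Sigma, 0 < rk a)
    (tau : term Sigma -> term Sigma -> Prop)
    (htau : forall t1 t2, tau t1 t2 -> is_tree t1 /\ is_tree t2) :
  mcft_transduction tau <-> dmt_fc_bimorphism tau.
Proof.
split; first exact: mcft_transduction_bimorphism.
exact: bimorphism_mcft_transduction.
Qed.
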